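(* There is an absolute constant $c>0$ such that for every $n\ge 1$ and every rational matrix $\mathbf{M}\in\mathbb{Q}^{n\times n}$ that is a $\mathcal{P}_*$-matrix, with $L=\operatorname{length}(\mathbf{M})$ its binary encoding length, one has $\hat\kappa(\mathbf{M})\le 2^{c\,nL}$ (that is, $\hat\kappa(\mathbf{M})\le 2^{O(nL)}$).
   Context: For $\mathbf{M}\in\mathbb{R}^{n\times n}$ and $x\in\mathbb{R}^n$ let $\mathcal{I}^+_{\mathbf{M}}(x)=\{i\in[n] : x_i(\mathbf{M}x)_i>0\}$. The handicap number of $\mathbf{M}$ is $$\hat\kappa(\mathbf{M})=\min\Big\{\kappa\ge 0 \;:\; x^\top \mathbf{M}x+4\kappa\sum_{i\in\mathcal{I}^+_{\mathbf{M}}(x)}x_i(\mathbf{M}x)_i\ge 0\ \ \forall x\in\mathbb{R}^n\Big\},$$ with $\hat\kappa(\mathbf{M})=\infty$ if no such $\kappa$ exists. $\mathbf{M}$ is a $\mathcal{P}_*$-matrix if $\hat\kappa(\mathbf{M})<\infty$ (equivalently, $\mathbf{M}$ belongs to $\mathcal{P}_*=\bigcup_{\kappa\ge0}\mathcal{P}_*(\kappa)$, where $\mathcal{P}_*(\kappa)$ is the set of matrices with $\hat\kappa(\mathbf{M})\le\kappa$). Encoding length: for an integer $p\ne0$, $\operatorname{length}(p)=1+\lceil\log_2|p|\rceil$, and $\operatorname{length}(0)=1$; for a rational number represented as $p/q$ with $p,q$ integers, $q\neq 0$, $\operatorname{length}(p/q)=\operatorname{length}(p)+\operatorname{length}(q)$;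 the encoding length of a matrix is the sum of the encoding lengths of all its entries. *)

(* Defs.v *)
From HB Require Import structures.
From mathcomp Require Import all_boot all_order all_algebra.
From mathcomp Require Import all_classical all_reals all_analysis.
From mathcomp Require Import ring lra.
Set Implicit Arguments.
Unset Strict Implicit.
Unset Printing Implicit Defensive.
Import Order.TTheory GRing.Theory Num.Theory.
Local Open Scope classical_set_scope.
Local Open Scope ring_scope.

Section Handicap.
Variables (R : realType) (n : nat).
Implicit Types (M : 'M[R]_n) (x : 'cV[R]_n) (k : R).

Definition Iplus M x : {set 'I_n} :=
  [set i | 0 < x i 0 * (M *m x) i 0]%SET.

Definition handicap_feasible M k : Prop :=
  0 <= k /\
  forall x, 0 <= (x^T *m M *m x) 0 0
                 + 4 * k * \sum_(i in Iplus M x) x i 0 * (M *m x) i 0.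

(* The infimum of the empty set is [+oo]; when the set is nonempty the infimum
   is a minimum (see [handicap_min] below). *)
Definition handicap M : \bar R :=
  ereal_inf [set k%:E | k in [set k | handicap_feasible M k]].

Definition Pstar M : Prop := (handicap M < +oo)%E.

Lemma handicap_min M k0 : handicap_feasible M k0 ->
  exists k, [/\ handicap M = k%:E, handicap_feasible M k &
    forall k', handicap_feasible M k' -> k <= k'].
Proof.
move=> k0F; pose A := [set k | handicap_feasible M k].
have A0 : A !=set0 by exists k0.
have Alb : has_lbound A by exists 0 => k [].
have minA k' : A k' -> inf A <= k' by move=> Ak'; exact: ge_inf.
exists (inf A); split=> //; first by rewrite /handicap ereal_inf_EFin.
split; first by apply: lb_le_inf => // k [].
move=> x; set q := (_ *m _ *m _) 0 0; set s := \sum_(i in _) _.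
have : 0 <= s by apply: sumr_ge0 => i; rewrite inE => /ltW.
rewrite le_eqVlt => /orP[/eqP s0|s_gt0].
  by have := k0F.2 x; rewrite -/q -/s -s0 !mulr0.
have : - q / (4 * s) <= inf A.
  apply: lb_le_inf => // k [_ /(_ x)]; rewrite -/q -/s => qk.
  by rewrite ler_pdivrMr ?mulr_gt0//; lra.
by rewrite ler_pdivrMr ?mulr_gt0//; lra.
Qed.

Lemma PstarP M : Pstar M <-> exists k, handicap_feasible M k.
Proof.
split=> [/ereal_inf_lt[_ [k Fk _] _]|[k /handicap_min[k' [Ek' _ _]]]].
  by exists k.
by rewrite /Pstar Ek' ltry.
Qed.

End Handicap.

(* [up_log 2 m] is the least [e] with [m <= 2 ^ e], that is, the ceiling of the
   base-2 logarithm of [m] when [m > 0]. *)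
Definition length_int (p : int) : nat :=
  if p == 0 then 1%N else (1 + up_log 2 `|p|)%N.

Definition length_frac (p q : int) : nat := (length_int p + length_int q)%N.

(* The encoding length depends on the integer fractions chosen to write the
   entries, which need not be in lowest terms: [represents P Q M] says that the
   entries of [M] are written as the fractions [P i j / Q i j]. *)
Definition represents n (P Q : 'M[int]_n) (M : 'M[rat]_n) : Prop :=
  forall i j, Q i j != 0 /\ M i j = (P i j)%:Q / (Q i j)%:Q.

Definition length_mx n (P Q : 'M[int]_n) : nat :=
  (\sum_(i < n) \sum_(j < n) length_frac (P i j) (Q i j))%N.

(* Main.v *)
Require Import Defs.
From mathcomp Require Import all_boot all_order all_algebra.
From mathcomp Require Import all_classical all_reals all_analysis.
From mathcomp Require Import perm polyrcf ring lra.
Import Order.TTheory GRing.Theory Num.Theory.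
Local Open Scope ring_scope.
Set Implicit Arguments.
Unset Strict Implicit.
Unset Printing Implicit Defensive.

(** A positive handicap [k] is, up to the change of variable [s = 1 + 4 * k], a
    root of a nonzero integer polynomial of degree O(n) with
    coefficients of size 2^O(nL); Cauchy's root bound then gives the theorem.

    Clearing denominators multiplies [M] by a positive integer, which does not
    change the handicap; so let [A] be an integer matrix with entries at most
    2^(2L).  Fix the signs of the coordinates of [x] and of [A x].  They define
    a polyhedral cone [C], given by inequalities [G x >= 0], on which the
    function of the handicap condition is one quadratic form
    [q_s = q_0 + s * q_1] (up to a factor 2): [q_1] is the sum of
    [x_i (A x)_i] over the indices [i] with equal signs, [q_0] the sum over the
    others.  So [k] is the least value for which all the [q_s] are nonnegative
    on their cones, and as there are finitely many sign patterns, one of them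
    is violated for all [s] up to the critical value ([nested_pigeonhole]).

    For this pattern take a face [F] of [C], with linear span [V], that is
    minimal among those on which [q_s] is violated for all [s] below the
    critical value ([critical_face]).  Just below the critical value [q_s] has a
    negative value on [F] and none on the proper faces of [F].  Following a
    line through a negative point until it leaves the cone on both sides shows
    that [q_s] is positive on [V] outside [F] and [-F] ([pos_off_cone]): it is
    a Lorentzian form whose timelike vectors lie in [F] or [-F].  In particular
    it is nondegenerate on [V].  If it were still nondegenerate at the critical
    value, the vector [v_s] of [V] that represents the linear form sum_j
    (G x)_j through [q_s] would depend continuously on [s]; as [- v_s] lies in
    [F] before the critical value ([riesz_vector_in_cone]), it would also do so
    at the critical value, where [q_s] is nonnegative on [F], and this forces
    [v_s = 0], which is absurd.  Hence [q_s] degenerates on [V] at the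
    critical value, but not just before it ([threshold_is_root]).

    To read this degeneracy on a determinant with small entries, [V] is not
    given by a basis, whose entries would already be minors of [A], but by
    equations: the bordered matrix [kkt_mx], built with independent equations
    of [V], is singular exactly when the form is degenerate on [V].  It has
    size 3n and its entries are polynomials in [s] of degree at most 1 with
    coefficients at most 2^O(L), whence the bound on its determinant
    ([det_pencil_poly]). *)

(** * Quadratic forms *)

Definition bil (R : comNzRingType) n (B : 'M[R]_n) (x y : 'cV[R]_n) : R :=
  (x^T *m B *m y) 0 0.

Section Bilinear.
Variables (R : comNzRingType) (n : nat).
Implicit Types (B : 'M[R]_n) (x y z : 'cV[R]_n) (a : R).

Lemma bilDl B x y z : bil B (x + y) z = bil B x z + bil B y z.
Proof. by rewrite /bil linearD /= !mulmxDl mxE. Qed.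

Lemma bilDr B x y z : bil B x (y + z) = bil B x y + bil B x z.
Proof. by rewrite /bil mulmxDr mxE. Qed.

Lemma bilZl B a x y : bil B (a *: x) y = a * bil B x y.
Proof. by rewrite /bil linearZ /= -!scalemxAl mxE. Qed.

Lemma bilZr B a x y : bil B x (a *: y) = a * bil B x y.
Proof. by rewrite /bil -scalemxAr mxE. Qed.

Lemma bilC B x y : B^T = B -> bil B x y = bil B y x.
Proof.
move=> sB; transitivity ((x^T *m B *m y)^T 0 0); first by rewrite mxE.
by rewrite !trmx_mul trmxK sB mulmxA.
Qed.

Lemma bilMDl a B0 B1 x y : bil (B0 + a *: B1) x y = bil B0 x y + a * bil B1 x y.
Proof. by rewrite /bil mulmxDr mulmxDl -scalemxAr -scalemxAl !mxE. Qed.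

Lemma bil_lin B x y a : B^T = B ->
  bil B (x + a *: y) (x + a *: y) =
  bil B x x + 2 * a * bil B x y + a ^+ 2 * bil B y y.
Proof.
move=> sB; rewrite !bilDl !bilDr !bilZl !bilZr (bilC y x sB).
by ring.
Qed.
End Bilinear.

(** * Faces of a polyhedral cone and negative vectors of a quadratic form *)

Section Faces.
Variables (R : realFieldType) (n m : nat) (G : 'M[R]_(m, n)).
Implicit Types (S : {set 'I_m}) (x u v : 'cV[R]_n) (B : 'M[R]_n).

Definition face_span S x : Prop := forall j, j \notin S -> (G *m x) j 0 = 0.

(** As [S] varies, this gives all the faces of the cone [G x >= 0]: the forms
    of index outside [S] vanish, those of index in [S] may vanish too. *)
Definition face S x : Prop := (forall j, 0 <= (G *m x) j 0) /\ face_span S x.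

Lemma face_spanD S x u a : face_span S x -> face_span S u ->
  face_span S (x + a *: u).
Proof.
move=> xS uS j jS; rewrite mulmxDr -scalemxAr !mxE.
by move: (xS j jS) (uS j jS); rewrite !mxE => -> ->; rewrite mulr0 addr0.
Qed.

(** Moving from [x] in the direction [u], the first inequality that is about to
    fail becomes an equality, so the half-line leaves through a smaller face. *)
Lemma exit_face S x u : face S x -> face_span S u ->
  (exists j, (G *m u) j 0 < 0) ->
  exists s : R, 0 <= s /\ exists2 j, j \in S & face (S :\ j) (x + s *: u).
Proof.
move=> [x0 xS] uS [j0 uj0].
pose r j := (G *m x) j 0 / - (G *m u) j 0.
case: (@arg_minP _ _ _ j0 (fun j => (G *m u) j 0 < 0) r uj0) => j uj jmin.
have rE i : (G *m (x + r j *: u)) i 0 = (G *m x) i 0 + r j * (G *m u) i 0.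
  by rewrite mulmxDr -scalemxAr !mxE.
have r0 : 0 <= r j by rewrite divr_ge0 ?x0 // oppr_ge0 ltW.
exists (r j); split=> //; exists j.
  by apply: contraLR uj => /uS ->; rewrite ltxx.
split=> i.
  rewrite rE; have [ui|ui] := ltP ((G *m u) i 0) 0; last first.
    by rewrite addr_ge0 ?x0// mulr_ge0.
  by have := jmin i ui; rewrite {2}/r ler_pdivlMr ?oppr_gt0// mulrN; lra.
rewrite !inE negb_and negbK rE => /orP[/eqP->|iS]; last first.
  by rewrite xS// uS// mulr0 addr0.
by rewrite /r; field; rewrite lt_eqF.
Qed.

(** A linear form that is positive on the nonzero vectors of the cone when the
    forms of [G] separate points. *)
Definition form_sum x : R := \sum_j (G *m x) j 0.

(** In this section the form is negative at a point [x0] of a face and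
    nonnegative on the smaller faces.  It then behaves as a Lorentzian form on the
    span of the face, with timelike cone inside the face and its opposite. *)
Section NegativeCone.
Hypothesis G_inj : forall x, G *m x = 0 -> x = 0.
Variables (S : {set 'I_m}) (B : 'M[R]_n) (x0 : 'cV[R]_n).
Hypothesis symB : B^T = B.
Hypothesis x0S : face S x0.
Hypothesis x0_lt0 : bil B x0 x0 < 0.
Hypothesis bd_ge0 : forall j, j \in S ->
  forall x, face (S :\ j) x -> 0 <= bil B x x.

(** The line through [x0] in the direction [u] leaves the face on both sides of
    [x0].  The form is a quadratic polynomial on this line, negative at [x0] and
    nonnegative at the two exit points, so its leading coefficient, the value at
    [u], is positive. *)
Lemma pos_off_cone u : face_span S u ->
    ~ face S u -> ~ face S (- u) -> 0 < bil B u u.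
Proof.
have H v : face_span S v -> ~ face S v ->
    exists s : R, 0 < s /\ 0 <= bil B (x0 + s *: v) (x0 + s *: v).
  move=> vS nv; have /(exit_face x0S vS)[s [s0 [j jS xj]]] :
      exists j, (G *m v) j 0 < 0.
    apply: contrapT => /forallNP h; apply: nv; split=> // j.
    by rewrite leNgt; apply/negP/h.
  exists s; split; last exact: bd_ge0 xj.
  rewrite lt_neqAle s0 andbT; apply: contraPneq (bd_ge0 jS xj) => <-.
  by rewrite scale0r addr0; apply/negP; rewrite -ltNge.
move=> uS nu nNu.
have NuS : face_span S (- u).
  by move=> j jS; rewrite mulmxN mxE uS// oppr0.
have [s [s0]] := H u uS nu; have [t [t0]] := H _ NuS nNu.
rewrite -scaleN1r scalerA !bil_lin// mulrN1 sqrrN.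
have q0 := x0_lt0; set q := bil B x0 x0 in q0 *; set b := bil B x0 u; set a := bil B u u.
move=> h1 h2.
have st : 0 < s * t by rewrite mulr_gt0.
(* The weights cancel the linear terms of the two exit values. *)
have : 0 <= s * (q + 2 * - t * b + t ^+ 2 * a) +
            t * (q + 2 * s * b + s ^+ 2 * a).
  by rewrite addr_ge0// mulr_ge0// ltW.
have -> : s * (q + 2 * - t * b + t ^+ 2 * a) + t * (q + 2 * s * b + s ^+ 2 * a)
   = (s + t) * q + (s * t) * (s + t) * a by ring.
move=> h; have : (s + t) * q < 0 by rewrite pmulr_rlt0 ?addr_gt0.
have st' : 0 < s * t * (s + t) by rewrite mulr_gt0 ?addr_gt0.
by move=> h3; rewrite -(pmulr_rgt0 _ st'); lra.
Qed.

Local Notation l := (form_sum).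

Lemma form_sum_face_eq0 u : face S u -> l u = 0 -> u = 0.
Proof.
move=> [u0 uS] lu; apply: G_inj; apply/colP => j; rewrite [RHS]mxE.
by have /psumr_eq0P -> := lu => // i _; apply: u0.
Qed.

Lemma form_sum_face_gt0 : 0 < l x0.
Proof.
rewrite lt_neqAle sumr_ge0 ?andbT => [|j _]; last by case: x0S.
apply/eqP => /esym/(form_sum_face_eq0 x0S) e; move: x0_lt0.
by rewrite e /bil mulmx0 mxE ltxx.
Qed.

Lemma form_sumD x y : l (x + y) = l x + l y.
Proof. by rewrite -big_split; apply: eq_bigr => j _; rewrite mulmxDr mxE. Qed.

Lemma form_sumZ a x : l (a *: x) = a * l x.
Proof. by rewrite big_distrr; apply: eq_bigr => j _; rewrite -scalemxAr mxE. Qed.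

(** The kernel of [form_sum] meets the face and its opposite only at 0, so
    [pos_off_cone] applies to its nonzero vectors. *)
Lemma pos_on_hyperplane u : face_span S u -> l u = 0 -> bil B u u <= 0 -> u = 0.
Proof.
move=> uS lu qu; have lNu : l (- u) = 0 by rewrite -scaleN1r form_sumZ lu mulr0.
have [/form_sum_face_eq0->//|nu] := pselect (face S u).
have [/form_sum_face_eq0 h|nNu] := pselect (face S (- u)).
  by rewrite -[u]opprK h// oppr0.
by have := pos_off_cone uS nu nNu; rewrite ltNge qu.
Qed.

(** The vector [v] that represents [form_sum] is orthogonal to the hyperplane of
    [pos_on_hyperplane], on which the form is positive; as the form takes
    negative values, it is negative at [v].  So [v] or [- v] is in the face,
    and the sign follows from [form_sum G v < 0]. *)
Lemma riesz_vector_in_cone v : face_span S v ->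
    (forall w, face_span S w -> bil B w v = l w) -> face S (- v).
Proof.
move=> vS hv; have l0 := form_sum_face_gt0; have x0V := x0S.2.
(* The projection of [x0] on the hyperplane along [v]. *)
pose u := x0 + (- (l x0 / l v)) *: v.
have vv := hv v vS; have xv := hv x0 x0V.
have v_neq0 : v <> 0.
  by move=> v0; move: l0; rewrite -xv v0 /bil mulmx0 mxE ltxx.
have lv : l v < 0.
  rewrite ltNge; apply/negP => lv0.
  have lv1 : l v != 0.
    by apply: contra_notN v_neq0 => /eqP e; apply: pos_on_hyperplane; rewrite ?vv ?e.
  have lvp : 0 < l v by rewrite lt_neqAle eq_sym lv1.
  have qu : bil B u u < 0.
    rewrite bil_lin// vv xv -addrA.
    have -> : 2 * - (l x0 / l v) * l x0 + (- (l x0 / l v)) ^+ 2 * l v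
        = - ((l x0) ^+ 2 / l v) by field.
    have : 0 < l x0 ^+ 2 / l v by rewrite divr_gt0 ?exprn_gt0.
    by have := x0_lt0; lra.
  have : u = 0.
    apply: pos_on_hyperplane; last exact: ltW.
      exact: face_spanD.
    by rewrite form_sumD form_sumZ mulNr divfK ?subrr.
  by move=> e; move: qu; rewrite e /bil mulmx0 mxE ltxx.
apply: contrapT => nNv.
have nv : ~ face S v.
  by move=> [v0 _]; move: lv; rewrite ltNge sumr_ge0.
by have := pos_off_cone vS nv nNv; rewrite vv ltNge ltW.
Qed.

(** Adding a multiple of [x0] to a kernel vector brings it into the hyperplane
    of [pos_on_hyperplane] without making the form positive.  So the kernel
    vector is a multiple of [x0], at which the form does not vanish. *)
Lemma kernel_eq0 u : face_span S u ->
  (forall w, face_span S w -> bil B w u = 0) -> u = 0.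
Proof.
move=> uS hu; have l0 := form_sum_face_gt0; have x0V := x0S.2.
pose a := - (l u / l x0); pose w := u + a *: x0.
have w0 : w = 0.
  apply: pos_on_hyperplane.
  - exact: face_spanD.
  - by rewrite form_sumD form_sumZ mulNr divfK ?subrr ?gt_eqF.
  - rewrite bil_lin// bilC// !hu// mulr0 !add0r.
    by rewrite mulr_ge0_le0 ?sqr_ge0 ?ltW.
have : bil B x0 w = 0 by rewrite w0 /bil mulmx0 mxE.
rewrite bilDr bilZr hu// add0r => /eqP; rewrite mulf_eq0 (lt_eqF x0_lt0) orbF.
by move=> /eqP a0; rewrite -w0 /w a0 scale0r addr0.
Qed.

End NegativeCone.
End Faces.

(** * Degeneracy on a subspace given by equations *)

Definition select_mx (R : comNzRingType) m (Z : {set 'I_m}) : 'M[R]_m :=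
  diag_mx (\row_j (j \in Z)%:R).

(** The matrix of the optimality conditions for [B] under the constraints
    [(G x)_j = 0], [j] in [Z], with one multiplier per row of [G].  The lower
    right block sets the multipliers of the rows outside [Z] to 0, which keeps
    the size independent of [Z]. *)
Definition kkt_mx (R : comNzRingType) n m (B : 'M[R]_n) (G : 'M[R]_(m, n))
    (Z : {set 'I_m}) : 'M[R]_(n + m) :=
  block_mx B (G^T *m select_mx R Z) (select_mx R Z *m G) (1%:M - select_mx R Z).

Lemma map_select_mx (R R' : comNzRingType) (f : {rmorphism R -> R'}) m
    (Z : {set 'I_m}) : map_mx f (select_mx R Z) = select_mx R' Z.
Proof. by rewrite map_diag_mx; congr diag_mx; apply/rowP => j; rewrite !mxE rmorph_nat. Qed.

Lemma map_kkt_mx (R R' : comNzRingType) (f : {rmorphism R -> R'}) n m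
    (B : 'M[R]_n) (G : 'M[R]_(m, n)) (Z : {set 'I_m}) :
  map_mx f (kkt_mx B G Z) = kkt_mx (map_mx f B) (map_mx f G) Z.
Proof.
by rewrite /kkt_mx map_block_mx !map_mxM map_trmx map_mxB map_mx1 !map_select_mx.
Qed.

Lemma select_mxE (R : comNzRingType) m (Z : {set 'I_m}) (u : 'cV[R]_m) j :
  (select_mx R Z *m u) j 0 = (j \in Z)%:R * u j 0.
Proof. by rewrite mul_diag_mx !mxE. Qed.

Section KKT.
Variables (R : fieldType) (n m : nat) (G : 'M[R]_(m, n)).
Implicit Types (B : 'M[R]_n) (Z : {set 'I_m}).

Lemma kkt_mxP B Z (v a : 'cV[R]_n) (u : 'cV[R]_m) :
  kkt_mx B G Z *m col_mx v u = col_mx a 0 ->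
  [/\ forall j, j \notin Z -> u j 0 = 0,
      forall j, j \in Z -> (G *m v) j 0 = 0 &
      B *m v + G^T *m u = a].
Proof.
rewrite mul_block_col => /eq_col_mx[ea e0].
have e j : (j \in Z)%:R * (G *m v) j 0 + (u j 0 - (j \in Z)%:R * u j 0) = 0.
  have := congr1 (fun w : 'cV_m => w j 0) e0 => ej.
  rewrite -mulmxA mulmxBl mul1mx [LHS]mxE [X in _ + X = _]mxE in ej.
  rewrite [X in _ + (_ + X) = _]mxE !select_mxE [RHS]mxE in ej.
  exact: ej.
have uZ j : j \notin Z -> u j 0 = 0.
  by move=> /negPf jZ; have := e j; rewrite jZ !mul0r add0r subr0.
split=> // [j jZ|]; first by have := e j; rewrite jZ !mul1r subrr addr0.
rewrite -ea -mulmxA; congr (_ + _ *m _); apply/colP => j.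
by rewrite select_mxE; case: (boolP (j \in Z)) => [_|/uZ->]; rewrite ?mul1r ?mulr0.
Qed.

(** On the subspace that the equations define the multipliers contribute
    nothing, so a solution represents the linear form given by [a]. *)
Lemma kkt_bil B Z (v a : 'cV[R]_n) (u : 'cV[R]_m) :
  kkt_mx B G Z *m col_mx v u = col_mx a 0 ->
  forall w : 'cV_n, (forall j, j \in Z -> (G *m w) j 0 = 0) ->
  bil B w v = (w^T *m a) 0 0.
Proof.
move=> /kkt_mxP[uZ vZ <-] w wZ; rewrite mulmxDr [RHS]mxE mulmxA.
rewrite [X in _ + X](_ : _ = 0) ?addr0// mulmxA -trmx_mul mxE big1// => j _.
rewrite mxE; case: (boolP (j \in Z)) => [/wZ->|/uZ->].
  by rewrite mul0r.
by rewrite mulr0.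
Qed.

Definition defines_span S Z : Prop :=
  Z \subset ~: S /\
  forall x : 'cV[R]_n, (forall j, j \in Z -> (G *m x) j 0 = 0) ->
    forall j, j \notin S -> (G *m x) j 0 = 0.

(** In a minimal system of equations of the span no equation is a combination of
    the others, so the only combination that vanishes is trivial.  Without
    independence the multipliers would not be unique and [kkt_mx] would be
    singular for every form. *)
Lemma independent_equations S : exists Z, defines_span S Z /\
  forall u : 'cV[R]_m, (forall j, j \notin Z -> u j 0 = 0) ->
    G^T *m u = 0 -> u = 0.
Proof.
have [|Z /minsetP[/asboolP[ZS Zdef] Zmin]] :=
    @ex_minset _ (fun Z => `[< defines_span S Z >]).
  exists (~: S); apply/asboolP; split=> // x xS j jS.
  by apply: xS; rewrite inE.
exists Z; split=> // u uZ Gu; apply/colP => j; rewrite [RHS]mxE.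
case: (boolP (j \in Z)) => [jZ|/uZ//]; apply/eqP/negPn/negP => uj.
suff : Z :\ j = Z by move/setP/(_ j); rewrite !inE eqxx jZ.
apply: Zmin; last exact: subD1set.
apply/asboolP; split=> [|x xZ]; first exact: fintype.subset_trans (subD1set _ _) ZS.
apply: Zdef => i iZ; have [->|ij] := eqVneq i j; last by apply: xZ; rewrite !inE ij.
have : (u^T *m (G *m x)) 0 0 = 0.
  by rewrite mulmxA -[u^T *m G]trmxK trmx_mul trmxK Gu trmx0 mul0mx mxE.
rewrite mxE (bigD1 j)//= big1 ?addr0 => [|k kj].
  by rewrite mxE => /eqP; rewrite mulf_eq0 (negPf uj) => /eqP.
rewrite mxE; case: (boolP (k \in Z)) => [kZ|/uZ->]; last by rewrite mul0r.
by rewrite xZ ?mulr0// !inE kj.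
Qed.

Lemma kkt_det_neq0 B Z :
  (forall u : 'cV[R]_m, (forall j, j \notin Z -> u j 0 = 0) ->
     G^T *m u = 0 -> u = 0) ->
  (forall v : 'cV[R]_n, (forall j, j \in Z -> (G *m v) j 0 = 0) ->
     (forall w : 'cV_n, (forall j, j \in Z -> (G *m w) j 0 = 0) ->
        bil B w v = 0) -> v = 0) ->
  \det (kkt_mx B G Z) != 0.
Proof.
move=> indep nondeg; rewrite -det_tr; apply/det0P => -[r r0 rE].
have : kkt_mx B G Z *m col_mx (usubmx r^T) (dsubmx r^T) = col_mx 0 0.
  by rewrite vsubmxK col_mx0 -[LHS]trmxK trmx_mul trmxK rE trmx0.
move=> E; have [uZ vZ e] := kkt_mxP E.
have v0 : usubmx r^T = 0.
  apply: nondeg => // w wZ; by rewrite (kkt_bil E)// mulmx0 mxE.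
have u0 : dsubmx r^T = 0.
  by apply: indep => //; move: e; rewrite v0 mulmx0 add0r.
by case/eqP: r0; rewrite -[r]trmxK -[r^T]vsubmxK v0 u0 col_mx0 trmx0.
Qed.
End KKT.

(** * The critical parameter of a pencil of quadratic forms *)

Lemma poly_ge0_left_limit (R : rcfType) (p : {poly R}) a b : a < b ->
  (forall t, a <= t < b -> 0 <= p.[t]) -> 0 <= p.[b].
Proof.
move=> ab pge0; rewrite leNgt; apply/negP => pb.
have [|d d0 pd] := @poly_cont _ b p (- p.[b]); first by rewrite oppr_gt0.
pose t := Num.max a (b - d / 2).
have tb : a <= t < b by rewrite le_max lexx gt_max ab/= gtrBl divr_gt0.
have /pd : `|t - b| < d.
  rewrite distrC gtr0_norm ?subr_gt0; last by case/andP: tb.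
  have : b - d / 2 <= t by rewrite le_max lexx orbT.
  by lra.
by have := pge0 t tb => pt; rewrite ltr_distl => /andP[_]; lra.
Qed.

(** As each [P i] is closed downwards, an index that fails somewhere fails near
    [b]; if all of them failed, they would all fail at the largest of finitely
    many parameters. *)
Lemma nested_pigeonhole (R : realDomainType) (I : finType) (P : I -> R -> Prop) a b :
    a < b ->
    (forall i t t', a <= t -> t <= t' -> t' < b -> P i t' -> P i t) ->
    (forall t, a <= t < b -> exists i, P i t) ->
  exists i, forall t, a <= t < b -> P i t.
Proof.
move=> ab Pmono Pex; apply: contrapT => /forallNP none.
have /fin_all_exists[T HT] : forall i, exists t, a <= t < b /\ ~ P i t.
  by move=> i; have /existsNP[t /not_implyP] := none i; exists t.
pose t1 := \big[Order.max/a]_i T i.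
have t1ab : a <= t1 < b.
  rewrite bigmax_ge_id/=; apply: bigmax_lt => // i _.
  by have [/andP[]] := HT i.
have [i Pi] := Pex _ t1ab; have [/andP[aT _]] := HT i; apply.
apply: Pmono Pi => //; first exact: le_bigmax.
by case/andP: t1ab.
Qed.

(** Here [k] is the critical parameter: the form [B0 + t *: B1] is nonnegative
    on the cone for [t = k] but not for [a <= t < k]. *)
Section Threshold.
Variables (R : rcfType) (n m : nat) (B0 B1 : 'M[R]_n) (G : 'M[R]_(m, n)).
Variables (a k : R).
Local Notation B t := (B0 + t *: B1).
Local Notation cone := (face G [set: 'I_m]%SET).
Hypothesis symB0 : B0^T = B0.
Hypothesis symB1 : B1^T = B1.
Hypothesis G_inj : forall x : 'cV_n, G *m x = 0 -> x = 0.
Hypothesis ak : a < k.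
Hypothesis B1_ge0 : forall x, cone x -> 0 <= bil B1 x x.
Hypothesis Bk_ge0 : forall x, cone x -> 0 <= bil (B k) x x.
Hypothesis violated : forall t, a <= t < k ->
  exists x, cone x /\ bil (B t) x x < 0.

Let violator S t := exists x, face G S x /\ bil (B t) x x < 0.

Lemma face_cone S x : face G S x -> cone x.
Proof. by case=> x0 _; split=> // j; rewrite inE. Qed.

Lemma violatorW S t t' : t <= t' -> violator S t' -> violator S t.
Proof.
move=> tt' [x [xS xlt0]]; exists x; split=> //; apply: le_lt_trans xlt0.
by rewrite !bilMDl lerD2l ler_wpM2r// B1_ge0//; apply: face_cone xS.
Qed.

(** Among the faces violated for all parameters below [k] choose a minimal one.
    Each smaller face is violated only up to some parameter below [k], and there
    are finitely many of them. *)
Lemma critical_face : exists S a', [/\ a <= a' < k,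
  forall t, a' <= t < k -> violator S t &
  forall t j x, a' <= t < k -> j \in S -> face G (S :\ j) x ->
    0 <= bil (B t) x x].
Proof.
pose bad S := `[< forall t, a <= t < k -> violator S t >].
have [|S /minsetP[/asboolP Sbad Smin]] := @ex_minset _ bad.
  by exists [set: 'I_m]%SET; apply/asboolP.
have : ~ (forall t, a <= t < k -> exists S' : {set 'I_m}, S' \proper S /\ violator S' t).
  move=> /(nested_pigeonhole ak)[S' t t' _ tt' _ [? /(violatorW tt')//]|S' bad'].
  have /andP[S'S /negP] : S' \proper S.
    by have [|] := bad' a; rewrite ?lexx.
  apply; rewrite (Smin S')//; apply/asboolP => t /bad'[]//.
move=> /existsNP[a' /not_implyP[a'k noS']]; exists S, a'; split=> //.
- move=> t /andP[a't tk]; apply: Sbad; rewrite tk andbT.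
  by case/andP: a'k => /le_trans-> .
- move=> t j x /andP[a't tk] jS xF; rewrite leNgt; apply/negP => xlt0.
  apply: noS'; exists (S :\ j); split; first by rewrite properD1.
  by apply: (violatorW a't); exists x.
Qed.

(** If the bordered matrix were invertible at [k], the vector [v t] that
    represents [form_sum] would extend continuously to [t = k], and so would
    the membership of [- v t] in the critical face.  At [k] the form is
    nonnegative on that face, while its value at [- v k] is
    [form_sum G (v k) <= 0]; so [form_sum] vanishes at [- v k], whence
    [v k = 0], and [form_sum] is zero on the span of the face. *)
Lemma threshold_is_root : exists Z t,
  \det (kkt_mx (B t) G Z) != 0 /\ \det (kkt_mx (B k) G Z) = 0.
Proof.
have symB t : (B t)^T = B t by rewrite linearD linearZ /= symB0 symB1.
have [S [a' [a'k viol bd]]] := critical_face.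
have a'ltk : a' < k by case/andP: a'k.
have {}a'k : a' <= a' < k by rewrite lexx a'ltk.
have [Z [[ZS Zdef] Zind]] := independent_equations G S.
have spanP x : (forall j, j \in Z -> (G *m x) j 0 = 0) <-> face_span G S x.
  split; first exact: Zdef.
  by move=> xS j jZ; apply: xS; move/fintype.subsetP/(_ j jZ): ZS; rewrite inE.
have det_neq0 t : a' <= t < k -> \det (kkt_mx (B t) G Z) != 0.
  move=> tk; have [x0 [x0S x0lt0]] := viol t tk.
  apply: kkt_det_neq0 => // v /spanP vS hv.
  apply: (kernel_eq0 G_inj (symB t) x0S x0lt0) => // [j jS x|w /spanP].
    exact: bd.
  exact: hv.
exists Z, a'; split; first exact: det_neq0.
apply/eqP/negPn/negP => detk.
pose c : 'cV[R]_n := G^T *m const_mx 1.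
have cE w : (w^T *m c) 0 0 = form_sum G w.
  rewrite mulmxA -trmx_mul mxE; apply: eq_bigr => j _.
  by rewrite !mxE mulr1.
(* Cramer's rule without the division: [vhat t] is polynomial in [t]. *)
pose vhat t : 'cV[R]_n := usubmx (\adj (kkt_mx (B t) G Z) *m col_mx c 0).
have vhatP t : face_span G S (vhat t) /\ forall w, face_span G S w ->
    bil (B t) w (vhat t) = \det (kkt_mx (B t) G Z) * form_sum G w.
  have E : kkt_mx (B t) G Z *m col_mx (vhat t)
      (dsubmx (\adj (kkt_mx (B t) G Z) *m col_mx c 0)) =
      col_mx (\det (kkt_mx (B t) G Z) *: c) 0.
    by rewrite vsubmxK mulmxA mul_mx_adj mul_scalar_mx scale_col_mx scaler0.
  have [_ vZ _] := kkt_mxP E; split; first exact/spanP.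
  by move=> w /spanP wS; rewrite (kkt_bil E)// -scalemxAr mxE cE.
pose v t := (\det (kkt_mx (B t) G Z))^-1 *: vhat t.
have vP t : \det (kkt_mx (B t) G Z) != 0 -> face_span G S (v t) /\
    forall w, face_span G S w -> bil (B t) w (v t) = form_sum G w.
  move=> d0; have [vS vE] := vhatP t; split=> [j jS|w wS].
    by rewrite -scalemxAr mxE vS// mulr0.
  by rewrite bilZr vE// mulKf.
pose Ep := kkt_mx (map_mx polyC B0 + 'X *: map_mx polyC B1) (map_mx polyC G) Z.
have cst t p q (M : 'M[R]_(p, q)) : map_mx (horner_eval t) (map_mx polyC M) = M.
  by apply/matrixP => i j; rewrite !mxE /horner_eval hornerC.
have EpE t : map_mx (horner_eval t) Ep = kkt_mx (B t) G Z.
  rewrite map_kkt_mx map_mxD map_mxZ !cst.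
  by rewrite /= /horner_eval hornerX.
pose vp := usubmx (\adj Ep *m col_mx (map_mx polyC c) 0).
have vpE t : map_mx (horner_eval t) vp = vhat t.
  by rewrite map_usubmx map_mxM map_mx_adj EpE map_col_mx raddf0 cst.
(* The sign of [h j] is that of the form of index [j] at [- v t], because it
   differs from it by the square of the determinant. *)
pose h j := - (\det Ep * (map_mx polyC G *m vp) j 0).
have hE j t : (h j).[t] = - (\det (kkt_mx (B t) G Z) * (G *m vhat t) j 0).
  rewrite hornerN hornerM -vpE -EpE det_map_mx; congr (- (_ * _)).
  rewrite !mxE horner_sum; apply: eq_bigr => i _.
  by rewrite !mxE hornerM hornerC.
have hv j t : \det (kkt_mx (B t) G Z) != 0 ->
    (h j).[t] = (\det (kkt_mx (B t) G Z)) ^+ 2 * (G *m - v t) j 0.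
  move=> d0; rewrite hE mulmxN -scalemxAr [in RHS]mxE [in RHS]mxE.
  by field.
have vk : face G S (- v k).
  split=> j; last first.
    by move=> jS; rewrite mulmxN mxE (vP k detk).1// oppr0.
  suff : 0 <= (h j).[k] by rewrite hv// pmulr_rge0// exprn_even_gt0.
  apply: (poly_ge0_left_limit a'ltk) => t tk.
  have [x0 [x0S x0lt0]] := viol t tk; have dt := det_neq0 t tk.
  rewrite hv// mulr_ge0 ?sqr_ge0//.
  have [vtS vtE] := vP t dt.
  have [//|+ _] := riesz_vector_in_cone G_inj (symB t) x0S x0lt0 _ vtS vtE.
    by move=> i iS x; apply: bd.
  exact.
have [vkS vkE] := vP k detk.
have := Bk_ge0 (face_cone vk); rewrite -scaleN1r bilZl bilZr vkE// !mulN1r opprK => lv0.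
have lNv0 : 0 <= form_sum G (- v k) by apply: sumr_ge0 => j _; case: vk.
have lNv : form_sum G (- v k) = - form_sum G (v k).
  by rewrite -scaleN1r form_sumZ mulN1r.
have /(form_sum_face_eq0 G_inj vk) v0 : form_sum G (- v k) = 0 by lra.
have [x0 [x0S x0lt0]] := viol a' a'k.
have := form_sum_face_gt0 G_inj x0S x0lt0.
rewrite -vkE; last by case: x0S.
by rewrite -[v k]opprK v0 oppr0 /bil mulmx0 mxE ltxx.
Qed.
End Threshold.

(** * Integer polynomials with bounded coefficients *)

Definition l1norm (p : {poly int}) : int := \sum_(i < size p) `|p`_i|.

Lemma l1normE N (p : {poly int}) : (size p <= N)%N -> l1norm p = \sum_(i < N) `|p`_i|.
Proof.
move=> pN; rewrite /l1norm (big_ord_widen _ (fun i => `|p`_i|) pN) big_mkcond.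
apply: eq_bigr => i _; case: ltnP => // h.
by rewrite nth_default// normr0.
Qed.

Lemma l1normD p q : l1norm (p + q) <= l1norm p + l1norm q.
Proof.
pose N := maxn (size p) (size q).
rewrite !(@l1normE N) ?leq_maxl ?leq_maxr ?size_polyD// -big_split/=.
by apply: ler_sum => i _; rewrite coefD ler_normD.
Qed.

Lemma l1normC c : l1norm c%:P = `|c|.
Proof. by rewrite (@l1normE 1) ?size_polyC_leq1// big_ord1 coefC. Qed.

Lemma l1normMX p : l1norm (p * 'X) = l1norm p.
Proof.
rewrite (@l1normE (size p).+1); last first.
  by rewrite (leq_trans (size_polyMleq _ _))// size_polyX addn2.
rewrite big_ord_recl coefMX normr0 add0r; apply: eq_bigr => i _.
by rewrite coefMX.
Qed.

Lemma l1normMXC p c : l1norm (p * 'X + c%:P) = l1norm p + `|c|.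
Proof.
rewrite (@l1normE (size p).+1); last first.
  rewrite (leq_trans (size_polyD _ _))// geq_max.
  rewrite (leq_trans (size_polyMleq _ _)) ?size_polyX ?addn2//=.
  by rewrite (leq_trans (size_polyC_leq1 _)).
rewrite big_ord_recl coefD coefMX coefC add0r addrC; congr (_ + _).
by apply: eq_bigr => i _; rewrite coefD coefMX coefC addr0.
Qed.

Lemma l1normZ c q : l1norm (c *: q) = `|c| * l1norm q.
Proof.
rewrite (@l1normE (size q)) ?size_scale_leq// big_distrr.
by apply: eq_bigr => i _; rewrite coefZ normrM.
Qed.

Lemma l1norm_ge0 p : 0 <= l1norm p.
Proof. exact: sumr_ge0. Qed.

Lemma l1normM p q : l1norm (p * q) <= l1norm p * l1norm q.
Proof.
elim/poly_ind: p => [|p c IHp].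
  by rewrite mul0r -polyC0 l1normC normr0 mul0r.
rewrite l1normMXC mulrDl mul_polyC (le_trans (l1normD _ _))// mulrDl l1normZ.
by rewrite lerD2r -mulrA (mulrC 'X) mulrA l1normMX.
Qed.

Lemma l1norm_sum (I : finType) (F : I -> {poly int}) :
  l1norm (\sum_i F i) <= \sum_i l1norm (F i).
Proof.
elim/big_ind2: _ => [|p P q Q hp hq|//].
  by rewrite -polyC0 l1normC normr0.
by apply: le_trans (l1normD _ _) (lerD hp hq).
Qed.

Lemma l1norm_prod (I : finType) (F : I -> {poly int}) :
  l1norm (\prod_i F i) <= \prod_i l1norm (F i).
Proof.
suff /andP[] : 0 <= l1norm (\prod_i F i) <= \prod_i l1norm (F i) by [].
elim/big_ind2: _ => [|p P q Q /andP[p0 hp] /andP[q0 hq]|i _].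
- by rewrite -polyC1 l1normC normr1.
- by rewrite l1norm_ge0 (le_trans (l1normM _ _))// ler_pM.
- by rewrite l1norm_ge0 lexx.
Qed.

Lemma fact_leq_exp N : (N`! <= N ^ N)%N.
Proof.
elim: N => // N IHN; rewrite factS expnS leq_mul2l/= (leq_trans IHN)//.
by case: N {IHN} => // N; rewrite leq_exp2r.
Qed.

(** The Leibniz formula has N! <= N^N terms, each a product of N entries, and
    the norm is submultiplicative. *)
Lemma l1norm_det N (E : 'M[{poly int}]_N) (K : int) :
  (forall i j, l1norm (E i j) <= K) -> l1norm (\det E) <= (N%:R * K) ^+ N.
Proof.
move=> EK; rewrite (le_trans (l1norm_sum _))//.
apply: (@le_trans _ _ (\sum_(s : 'S_N) K ^+ N)).
  apply: ler_sum => s _; rewrite (le_trans (l1normM _ _))//.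
  have -> : l1norm ((-1) ^+ s) = 1.
    have -> : (-1) ^+ s = ((-1) ^+ s)%:P :> {poly int}.
      by rewrite rmorphXn rmorphN1.
    by rewrite l1normC normrX normrN1 expr1n.
  rewrite mul1r (le_trans (l1norm_prod _))//.
  rewrite -[N in K ^+ N]card_ord -prodr_const.
  by apply: ler_prod => i _; rewrite l1norm_ge0 EK.
rewrite sumr_const card_Sn exprMn -[_ *+ N`!]mulr_natl.
have [->|K0] : K ^+ N = 0 \/ 0 <= K ^+ N.
  case: N E EK => [|N] E EK; first by right.
  by right; rewrite exprn_ge0// (le_trans (l1norm_ge0 _) (EK ord0 ord0)).
- by rewrite !mulr0.
- rewrite ler_wpM2r// -natrX ler_nat.
  exact: fact_leq_exp.
Qed.

(** Cauchy's bound, in which the leading coefficient, a nonzero integer, can be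
    replaced by 1. *)
Lemma root_le_l1norm (R : rcfType) (p : {poly int}) (x : R) :
  p != 0 -> (map_poly intr p).[x] = 0 -> x < 1 + (l1norm p)%:~R.
Proof.
move=> p0 px; have inj : injective (intr : int -> R) by apply: intr_inj.
have p0' : map_poly (intr : int -> R) p != 0.
  by rewrite map_poly_eq0_id0 ?intr_eq0 ?lead_coef_eq0.
apply: le_lt_trans (ler_norm _) _.
apply: lt_le_trans (cauchy_boundP p0' px) _; rewrite /cauchy_bound lerD2l.
have -> : \sum_(i < size (map_poly (intr : int -> R) p)) `|(map_poly intr p)`_i|
    = (l1norm p)%:~R :> R.
  rewrite size_map_inj_poly ?rmorph0// /l1norm rmorph_sum; apply: eq_bigr => i _.
  by rewrite coef_map /= intr_norm.
rewrite ler_piMl ?ler0z ?l1norm_ge0// lead_coef_map_inj ?rmorph0//.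
rewrite invf_le1 ?normr_gt0 ?intr_eq0 ?lead_coef_eq0// -intr_norm ler1z.
by rewrite -gtz0_ge1 normr_gt0 lead_coef_eq0.
Qed.

(** * Encoding lengths *)

Lemma norm_le_length p : `|p| <= 2 ^+ length_int p.
Proof.
rewrite /length_int; case: eqVneq => [->|p0]; first by rewrite normr0.
rewrite -natrX -abszE -natz ler_nat.
apply: leq_trans (up_logP `|p|%N (isT : 1 < 2)%N) _.
by rewrite leq_exp2l ?leq_addl.
Qed.

(** The common denominator is the product of the squares of all the
    denominators, rather than of the denominators, so as to be positive. *)
Lemma clear_denominators n (M : 'M[rat]_n) (P Q : 'M[int]_n) :
  represents P Q M -> exists (d : int) (A : 'M[int]_n),
    [/\ 0 < d, forall i j, d%:~R * M i j = (A i j)%:~R &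
        forall i j, `|A i j| <= 2 ^+ (2 * length_mx P Q)].
Proof.
move=> PQM.
pose F (k : 'I_n * 'I_n) := Q k.1 k.2 ^+ 2.
pose d := \prod_k F k.
pose A := \matrix_(i, j) (P i j * Q i j * \prod_(k | k != (i, j)) F k).
exists d, A; split=> [|i j|i j].
- apply: prodr_gt0 => -[i j] _; rewrite /F/= exprn_even_gt0//=.
  by have [] := PQM i j.
- have [Q0 ->] := PQM i j; have Q0' : (Q i j)%:Q != 0 by rewrite intr_eq0.
  rewrite mxE /d (bigD1 (i, j))//= /F/= !rmorphM/=.
  by field.
- rewrite mxE /length_mx pair_big/= big_distrr/= expr_sum/=.
  rewrite [leRHS](bigD1 (i, j))//= normrM normr_prod.
  apply: ler_pM => //; first exact: prodr_ge0.
    by rewrite normrM mul2n -addnn exprD ler_pM//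
      (le_trans (norm_le_length _))// ler_weXn2l// ?leq_addr ?leq_addl.
  apply: ler_prod => k _; rewrite normr_ge0/= /F normrX.
  rewrite mulnC exprM lerXn2r// ?nnegrE ?exprn_ge0//.
  by rewrite (le_trans (norm_le_length _))// ler_weXn2l// leq_addl.
Qed.

Lemma size_le_length n (P Q : 'M[int]_n) : (1 <= n)%N ->
  (n <= length_mx P Q)%N /\ (2 <= length_mx P Q)%N.
Proof.
move=> n0; have len1 p : (1 <= length_int p)%N by rewrite /length_int; case: ifP.
have row i : (2 <= \sum_(j < n) length_frac (P i j) (Q i j))%N.
  rewrite (bigD1 i)//= (leq_trans _ (leq_addr _ _))//.
  exact: (leq_add (len1 _) (len1 _)).
have : (n * 2 <= length_mx P Q)%N.
  rewrite -[n in (n * _)%N]card_ord -sum_nat_const; apply: leq_sum => i _.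
  exact: row.
move=> h; split; apply: leq_trans h; first by rewrite leq_pmulr.
by rewrite leq_pmull.
Qed.

(** With N = 3n the base is 12 n 2^(2L) <= 2^(2L) 2^L 2^(2L), because 12 <= 2^4
    and 2 <= L. *)
Lemma size_bound_le_exp n L : (n <= L)%N -> (2 <= L)%N ->
  (((n + (n + n))%:R * (4 * 2 ^+ (2 * L))) ^+ (n + (n + n)) : int)
    <= 2 ^+ (15 * n * L).
Proof.
move=> nL L2; have -> : (15 * n * L = (5 * L) * (n + (n + n)))%N by ring.
rewrite [leRHS]exprM lerXn2r ?nnegrE ?exprn_ge0 ?mulr_ge0//.
have -> : (5 * L = 2 * L + L + 2 * L)%N by ring.
have n2 : (n%:R : int) <= 2 ^+ L.
  by rewrite -natrX ler_nat (leq_trans nL)// ltnW// ltn_expl.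
have L4 : (2 : int) ^+ 4 <= 2 ^+ (2 * L).
  by rewrite ler_weXn2l// (@leq_mul 2 2).
rewrite (exprD _ (2 * L + L)) (exprD _ (2 * L)) mulrA ler_wpM2r ?exprn_ge0//.
have -> : (n + (n + n))%:R * 4 = 12 * n%:R :> int by rewrite !natrD; ring.
have ? : 12 <= 2 ^+ (2 * L) :> int by exact: le_trans _ L4.
by apply: ler_pM.
Qed.

(** * The determinant of the bordered matrix as an integer polynomial *)

(** The entries of the bordered matrix are polynomials of degree at most 1 in
    the parameter, of norm at most [4 * K]. *)
Lemma det_pencil_poly (R : comNzRingType) n m (B0 B1 : 'M[int]_n)
    (G : 'M[int]_(m, n)) (Z : {set 'I_m}) (K : int) :
    1 <= K -> (forall i j, `|B0 i j| <= 2 * K) ->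
    (forall i j, `|B1 i j| <= 2 * K) -> (forall i j, `|G i j| <= K) ->
  exists p : {poly int}, l1norm p <= ((n + m)%:R * (4 * K)) ^+ (n + m) /\
    forall t : R, (map_poly intr p).[t] =
      \det (kkt_mx (map_mx intr B0 + t *: map_mx intr B1) (map_mx intr G) Z).
Proof.
move=> K1 B0K B1K GK.
exists (\det (kkt_mx (map_mx polyC B0 + 'X *: map_mx polyC B1)
                     (map_mx polyC G) Z)); split=> [|t]; last first.
  rewrite -det_map_mx map_kkt_mx -[LHS]/(horner_eval t _) -det_map_mx map_kkt_mx.
  have cst p q (M : 'M[int]_(p, q)) : map_mx (horner_eval t)
      (map_mx (map_poly intr) (map_mx polyC M)) = map_mx intr M.
    by apply/matrixP => i j; rewrite !mxE map_polyC /horner_eval hornerC.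
  rewrite !cst; congr (\det (kkt_mx _ _ _)).
  by rewrite !map_mxD !map_mxZ !cst /= map_polyX /horner_eval hornerX.
have K0 : 0 <= K by apply: le_trans K1.
apply: l1norm_det => i j; rewrite /kkt_mx.
case: (split_ordP i) => {}i ->; case: (split_ordP j) => {}j ->.
- rewrite block_mxEul !mxE addrC mulrC.
  by rewrite l1normMXC l1normC; have := B0K i j; have := B1K i j; lra.
- rewrite block_mxEur mul_mx_diag !mxE -polyC_natr -polyCM l1normC normrM.
  by case: (j \in Z); rewrite ?normr1 ?normr0; have := GK j i; lra.
- rewrite block_mxEdl mul_diag_mx !mxE -polyC_natr -polyCM l1normC normrM.
  by case: (i \in Z); rewrite ?normr1 ?normr0; have := GK i j; lra.
- rewrite block_mxEdr !mxE; case: eqVneq => [->|_].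
    rewrite !mulr1n -polyC_natr -polyCB l1normC.
    by case: (_ \in Z); rewrite ?subrr ?subr0 ?normr1 ?normr0; lra.
  by rewrite !mulr0n subrr -polyC0 l1normC normr0; lra.
Qed.

(** * Sign patterns *)

Section SignPattern.
Variables (R : comNzRingType) (n : nat).
Implicit Types (X Y : {set 'I_n}) (A : 'M[R]_n).

(** [X] is the set of the indices with sign [+]. *)
Definition sign_mx X : 'M[R]_n := diag_mx (\row_i (-1) ^+ (i \notin X)).

Definition pattern_forms X Y A : 'M[R]_(n + n, n) :=
  col_mx (sign_mx X) (sign_mx Y *m A).

Definition agree X Y : {set 'I_n} := [set i | (i \in X) == (i \in Y)]%SET.

Definition sym_select J A : 'M[R]_n :=
  select_mx R J *m A + (select_mx R J *m A)^T.

Lemma sym_selectT J A : (sym_select J A)^T = sym_select J A.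
Proof. by rewrite /sym_select linearD /= trmxK addrC. Qed.

Lemma bil_sym_select J A x :
  bil (sym_select J A) x x = 2 * \sum_(i in J) x i 0 * (A *m x) i 0.
Proof.
have E : bil (select_mx R J *m A) x x = \sum_(i in J) x i 0 * (A *m x) i 0.
  rewrite /bil -!mulmxA mulmxA [x^T *m _](_ : _ = (select_mx R J *m x)^T).
    rewrite mxE [RHS]big_mkcond; apply: eq_bigr => i _.
    by rewrite mxE select_mxE; case: (i \in J); rewrite ?mul1r ?mul0r.
  by rewrite trmx_mul tr_diag_mx.
have ET : bil (select_mx R J *m A)^T x x = bil (select_mx R J *m A) x x.
  rewrite /bil; transitivity ((x^T *m (select_mx R J *m A) *m x)^T 0 0).
    by rewrite !trmx_mul trmxK mulmxA.
  by rewrite mxE.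
rewrite -E mulr_natl mulr2n -{2}ET.
by rewrite /bil mulmxDr mulmxDl mxE.
Qed.

End SignPattern.

Lemma map_sign_mx (R R' : comNzRingType) (f : {rmorphism R -> R'}) n
    (X : {set 'I_n}) : map_mx f (sign_mx R X) = sign_mx R' X.
Proof. by rewrite map_diag_mx; congr diag_mx; apply/rowP => j; rewrite !mxE rmorph_sign. Qed.

Lemma map_pattern_forms (R R' : comNzRingType) (f : {rmorphism R -> R'}) n
    (X Y : {set 'I_n}) (A : 'M[R]_n) :
  map_mx f (pattern_forms X Y A) = pattern_forms X Y (map_mx f A).
Proof. by rewrite map_col_mx map_mxM !map_sign_mx. Qed.

Lemma map_sym_select (R R' : comNzRingType) (f : {rmorphism R -> R'}) n
    (J : {set 'I_n}) (A : 'M[R]_n) :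
  map_mx f (sym_select J A) = sym_select J (map_mx f A).
Proof. by rewrite map_mxD -map_trmx map_mxM map_select_mx. Qed.

Lemma sym_select_norm n (J : {set 'I_n}) (A : 'M[int]_n) K i j :
  (forall i j, `|A i j| <= K) -> `|sym_select J A i j| <= 2 * K.
Proof.
have sel k l : `|A k l| <= K -> `|(select_mx int J *m A) k l| <= K.
  rewrite mul_diag_mx !mxE; case: (k \in J); rewrite ?mul1r// mul0r normr0.
  exact: le_trans.
move=> AK; rewrite mxE [(_^T) i j]mxE (le_trans (ler_normD _ _))//.
by have := sel i j (AK i j); have := sel j i (AK j i); lra.
Qed.

Lemma pattern_forms_norm n (X Y : {set 'I_n}) (A : 'M[int]_n) K i j :
  1 <= K -> (forall i j, `|A i j| <= K) -> `|pattern_forms X Y A i j| <= K.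
Proof.
move=> K1 AK; rewrite /pattern_forms.
case: (split_ordP i) => {}i ->; rewrite ?col_mxEu ?col_mxEd.
  rewrite !mxE; case: eqP => _; rewrite ?mulr1n ?normr_sign ?mulr0n ?normr0//.
  exact: le_trans K1.
by rewrite mul_diag_mx !mxE normrM normr_sign mul1r.
Qed.

Section RealPattern.
Variables (R : realType) (n : nat) (A : 'M[R]_n).
Implicit Types (X Y : {set 'I_n}) (x : 'cV[R]_n).

Local Notation cone X Y := (face (pattern_forms X Y A) [set: 'I_(n + n)]%SET).
Local Notation form X Y t :=
  (sym_select (~: agree X Y) A + t *: sym_select (agree X Y) A).

Lemma pattern_forms_inj X Y x : pattern_forms X Y A *m x = 0 -> x = 0.
Proof.
rewrite mul_col_mx -col_mx0 => /eq_col_mx[+ _] => /colP e; apply/colP => i.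
have := e i; rewrite mul_diag_mx !mxE => /eqP.
by rewrite mulf_eq0 signr_eq0 => /eqP.
Qed.

Lemma conePE X Y x : cone X Y x <->
  forall i, 0 <= (-1) ^+ (i \notin X) * x i 0 /\
            0 <= (-1) ^+ (i \notin Y) * (A *m x) i 0.
Proof.
have E1 i : (pattern_forms X Y A *m x) (lshift n i) 0 = (-1) ^+ (i \notin X) * x i 0.
  by rewrite mul_col_mx col_mxEu mul_diag_mx !mxE.
have E2 i : (pattern_forms X Y A *m x) (rshift n i) 0 =
    (-1) ^+ (i \notin Y) * (A *m x) i 0.
  by rewrite mul_col_mx col_mxEd -mulmxA mul_diag_mx !mxE.
split=> [[h _] i|h]; first by rewrite -E1 -E2.
split=> [j|j]; last by rewrite inE.
by case: (split_ordP j) => i ->; rewrite ?E1 ?E2; have [] := h i.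
Qed.

Lemma cone_agree X Y x i : cone X Y x ->
  if i \in agree X Y then 0 <= x i 0 * (A *m x) i 0
  else x i 0 * (A *m x) i 0 <= 0.
Proof.
move=> /conePE/(_ i)[]; rewrite inE.
case: (i \in X); case: (i \in Y) => /=; rewrite ?mul1r ?mulN1r => h1 h2.
- exact: mulr_ge0.
- by rewrite -oppr_ge0 -mulrN mulr_ge0.
- by rewrite -oppr_ge0 -mulNr mulr_ge0.
- by rewrite -mulrNN mulr_ge0.
Qed.

Lemma sum_agree X Y x : cone X Y x ->
  \sum_(i in agree X Y) x i 0 * (A *m x) i 0 =
  \sum_(i in Iplus A x) x i 0 * (A *m x) i 0.
Proof.
move=> xC; rewrite !big_mkcond [RHS]big_mkcond; apply: eq_bigr => i _.
have := cone_agree i xC; rewrite [in RHS]inE.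
by case: ifP => _; case: ltgtP.
Qed.

(** The products [x_i (A x)_i] have a constant sign on the cone of a pattern, so
    the indices of [Iplus] can be replaced by a set that depends on the pattern
    only.  The factor 2 comes from the symmetrisation. *)
Lemma pattern_form_handicap X Y x k : cone X Y x ->
  bil (form X Y (1 + 4 * k)) x x =
  2 * ((x^T *m A *m x) 0 0 +
       4 * k * \sum_(i in Iplus A x) x i 0 * (A *m x) i 0).
Proof.
move=> xC; rewrite bilMDl !bil_sym_select -(sum_agree xC).
have -> : (x^T *m A *m x) 0 0 =
    \sum_(i in ~: agree X Y) x i 0 * (A *m x) i 0 +
    \sum_(i in agree X Y) x i 0 * (A *m x) i 0.
  rewrite -mulmxA mxE (bigID (mem (agree X Y)))/= addrC; congr (_ + _).
    by apply: eq_big => i; rewrite ?inE ?mxE.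
  by apply: eq_bigr => i _; rewrite mxE.
by ring.
Qed.

Lemma cone_total x : exists X Y, cone X Y x.
Proof.
exists [set i | 0 <= x i 0]%SET, [set i | 0 <= (A *m x) i 0]%SET.
apply/conePE => i; rewrite !inE.
by split; [case: (lerP 0 (x i 0))|case: (lerP 0 ((A *m x) i 0))] => h;
  rewrite /= ?mul1r ?mulN1r ?oppr_ge0 // ltW.
Qed.

(** Every [t] with [1 <= t < 1 + 4 * k] is [1 + 4 * k'] for an infeasible
    [k'], so it has a violator in the cone of some pattern; one pattern serves for all [t],
    and [threshold_is_root] applies to it. *)
Lemma handicap_is_root k : 0 < k -> handicap_feasible A k ->
    (forall k', handicap_feasible A k' -> k <= k') ->
  exists X Y Z t,
    \det (kkt_mx (form X Y t) (pattern_forms X Y A) Z) != 0 /\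
    \det (kkt_mx (form X Y (1 + 4 * k)) (pattern_forms X Y A) Z) = 0.
Proof.
move=> k0 [_ kF] kmin.
have k1 : 1 < 1 + 4 * k by lra.
have J_ge0 X Y x : cone X Y x -> 0 <= bil (sym_select (agree X Y) A) x x.
  move=> xC; rewrite bil_sym_select mulr_ge0// sumr_ge0// => i iJ.
  by have := cone_agree i xC; rewrite iJ.
have := @nested_pigeonhole _ _ (fun XY : {set 'I_n} * {set 'I_n} => fun t =>
  exists x, cone XY.1 XY.2 x /\ bil (form XY.1 XY.2 t) x x < 0) _ _ k1.
case=> [[X Y] t t' _ tt' _ /= [x [xC xlt0]]|t /andP[t1 tk]|[X Y] /= viol].
- exists x; split=> //; apply: le_lt_trans xlt0.
  by rewrite !bilMDl lerD2l ler_wpM2r// J_ge0.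
- have tE : t = 1 + 4 * ((t - 1) / 4) by field.
  have : ~ handicap_feasible A ((t - 1) / 4).
    by move=> /kmin; rewrite leNgt => /negP; apply; rewrite ltr_pdivrMr; lra.
  move=> /not_andP[|/existsNP[x /negP]].
    by case; rewrite divr_ge0// subr_ge0.
  rewrite -ltNge => xlt0; have [X [Y xC]] := cone_total x.
  exists (X, Y), x; split=> //=.
  by rewrite tE pattern_form_handicap// pmulr_rlt0.
exists X, Y.
apply: (threshold_is_root _ _ (@pattern_forms_inj X Y) k1) => //.
- exact: sym_selectT.
- exact: sym_selectT.
- exact: J_ge0.
- by move=> x xC; rewrite pattern_form_handicap// mulr_ge0.
Qed.

End RealPattern.

(** * The bound *)

Lemma handicap_feasibleZ (R : realType) n (M : 'M[R]_n) d k : 0 < d ->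
  handicap_feasible (d *: M) k <-> handicap_feasible M k.
Proof.
move=> d0; have E x : (x^T *m (d *: M) *m x) 0 0 +
      4 * k * \sum_(i in Iplus (d *: M) x) x i 0 * ((d *: M) *m x) i 0 =
    d * ((x^T *m M *m x) 0 0 + 4 * k * \sum_(i in Iplus M x) x i 0 * (M *m x) i 0).
  have xE i : x i 0 * (d *: M *m x) i 0 = d * (x i 0 * (M *m x) i 0).
    by rewrite -scalemxAl mxE mulrCA.
  rewrite mulrDr; congr (_ + _); first by rewrite -scalemxAr -scalemxAl mxE.
  rewrite mulrCA; congr (_ * _); rewrite big_distrr/=.
  by apply: eq_big => [i|i _]; rewrite ?inE xE// pmulr_rgt0.
by split=> -[k0 kF]; split=> // x; have := kF x; rewrite E pmulr_rge0.
Qed.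

Lemma min_handicap_int_le (R : realType) n (A : 'M[int]_n) (K : int) (k : R) :
    1 <= K -> (forall i j, `|A i j| <= K) ->
    handicap_feasible (map_mx intr A) k ->
    (forall k', handicap_feasible (map_mx intr A) k' -> k <= k') ->
  k <= (((n + (n + n))%:R * (4 * K)) ^+ (n + (n + n)))%:~R.
Proof.
move=> K1 AK kF kmin; set b := (X in X%:~R).
have b0 : 0 <= b.
  by rewrite exprn_ge0// mulr_ge0// mulr_ge0// (le_trans _ K1).
have [k_le0|k0] := leP k 0; first by rewrite (le_trans k_le0)// ler0z.
have [X [Y [Z [t [dt dk]]]]] := handicap_is_root k0 kF kmin.
have [p [pb pE]] := @det_pencil_poly R _ _ (sym_select (~: agree X Y) A)
  (sym_select (agree X Y) A) (pattern_forms X Y A) Z K K1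
  (fun i j => sym_select_norm _ i j AK) (fun i j => sym_select_norm _ i j AK)
  (fun i j => pattern_forms_norm X Y i j K1 AK).
rewrite !map_sym_select map_pattern_forms in pE.
have p0 : p != 0.
  by apply: contraNneq dt => p0; rewrite -pE p0 rmorph0 horner0.
have := root_le_l1norm p0 (etrans (pE _) dk).
have : (l1norm p)%:~R <= b%:~R :> R by rewrite ler_int.
by lra.
Qed.

Theorem theorem1p2 (R : realType) :
  exists c : R, 0 < c /\
    forall (n : nat) (M : 'M[rat]_n) (P Q : 'M[int]_n),
      (1 <= n)%N ->
      represents P Q M ->
      Pstar (map_mx (@ratr R) M) ->
      (handicap (map_mx (@ratr R) M)
        <= (2 `^ (c * n%:R * (length_mx P Q)%:R))%:E)%E.
Proof.
exists 15; split=> // n M P Q n0 PQM /PstarP[k0 /handicap_min[k [-> kF kmin]]].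
have [d [A [d0 dM AL]]] := clear_denominators PQM.
set L := length_mx P Q in AL *.
have AE : map_mx (intr : int -> R) A = d%:~R *: map_mx ratr M.
  by apply/matrixP => i j; rewrite !mxE -[LHS]ratr_int -dM rmorphM /= ratr_int.
have d0R : 0 < d%:~R :> R by rewrite ltr0z.
have kF' : handicap_feasible (map_mx intr A) k.
  by rewrite AE; apply/handicap_feasibleZ.
have kmin' k' : handicap_feasible (map_mx intr A) k' -> k <= k'.
  by rewrite AE => /(handicap_feasibleZ _ _ d0R)/kmin.
have L1 : 1 <= 2 ^+ (2 * L) :> int by rewrite exprn_ege1.
have [nL L2] := size_le_length P Q n0.
rewrite lee_fin (le_trans (min_handicap_int_le L1 AL kF' kmin'))//.
rewrite -!natrM powR_mulrn//.
have -> : 2 ^+ (15 * n * L) = (2 ^+ (15 * n * L))%:~R :> R by rewrite rmorphXn.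
by rewrite ler_int size_bound_le_exp.
Qed.
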